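(* Let $k\ge1$ and $C>1$. On $\mathbb S^1\times\mathbb T^{k+1}$ consider $$g=dt^2+e^{2u(t)}dx^2+e^{2v(t)}\sum_{\alpha=1}^k dy_\alpha^2,$$ where $u$ and $v$ are (smooth and) periodic. If the Ricci eigenvalues satisfy $\rho_0=C\rho_1$ identically, then $u$ and $v$ are constant and $g$ is flat.
   Context: Here $t$ is the coordinate on $\mathbb S^1$ and $(x,y_1,\dots,y_k)$ are coordinates on the flat torus $\mathbb T^{k+1}$. $\rho_0$ is the Ricci eigenvalue in the direction $\partial_t$ and $\rho_1$ the Ricci eigenvalue in the direction $e^{-u}\partial_x$; with $A=u'$, $B=v'$ they are $$\rho_0=-(A'+A^2)-k(B'+B^2),\qquad \rho_1=-(A'+A^2)-kAB.$$ *)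

(* Defs.v *)
From HB Require Import structures.
From mathcomp Require Import all_boot all_order all_algebra.
From mathcomp Require Import all_classical all_reals all_analysis.

Set Implicit Arguments.
Unset Strict Implicit.
Unset Printing Implicit Defensive.

Import Order.TTheory GRing.Theory Num.Theory.
Import numFieldNormedType.Exports.

Local Open Scope classical_set_scope.
Local Open Scope ring_scope.

Definition smooth (R : realType) (f : R -> R) : Prop :=
  forall (m : nat) (t : R), derivable (derive1n m f) t 1.

Section Curvature.
Variables (R : realType) (n : nat).
(* [g p i j] is the coefficient g_ij of a metric at the point p of R^n. *)
Variable g : 'rV[R]_n -> 'M[R]_n.

Definition partial (i : 'I_n) (f : 'rV[R]_n -> R) (p : 'rV[R]_n) : R :=
  'D_(delta_mx 0 i) f p.

(* Gamma^a_bc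
   = 1/2 sum_d g^ad (d_b g_dc + d_c g_db - d_d g_bc). *)
Definition christoffel (a b c : 'I_n) (p : 'rV[R]_n) : R :=
  2^-1 * \sum_d invmx (g p) a d *
    (partial b (fun q => g q d c) p + partial c (fun q => g q d b) p
     - partial d (fun q => g q b c) p).

(* R^a_bcd = d_c Gamma^a_db - d_d Gamma^a_cb
     + sum_e (Gamma^a_ce Gamma^e_db - Gamma^a_de Gamma^e_cb),
   the components of
   R(X, Y)Z = nabla_X nabla_Y Z - nabla_Y nabla_X Z - nabla_[X,Y] Z
   with X = d_c, Y = d_d, Z = d_b. *)
Definition riemann (a b c d : 'I_n) (p : 'rV[R]_n) : R :=
  partial c (christoffel a d b) p - partial d (christoffel a c b) p
  + \sum_e (christoffel a c e p * christoffel e d b p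
            - christoffel a d e p * christoffel e c b p).

(* Contracted so that the Ricci curvature of round spheres is positive. *)
Definition ricci (p : 'rV[R]_n) : 'M[R]_n :=
  \matrix_(b, d) \sum_a riemann a b a d p.

(* The Ricci endomorphism, acting on row vectors on the right:
   w |-> w^b Ric_bc g^cd. *)
Definition ricci_endo (p : 'rV[R]_n) : 'M[R]_n := ricci p *m invmx (g p).

Definition ricci_eigenvalue_along (p w : 'rV[R]_n) (l : R) : Prop :=
  w != 0 /\ (w <= eigenspace (ricci_endo p) l)%MS.

Definition flat : Prop :=
  forall (a b c d : 'I_n) (p : 'rV[R]_n), riemann a b c d p = 0.

End Curvature.

(* Tensors on S^1 x T^(k+1) are handled through their lifts to the universal
   cover R^(k+2), with coordinates (t, x, y_1, ..., y_k) numbered from 0.  When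
   u and v have period L, the metric below is invariant under t |-> t + L and
   under all translations in x and y, so it descends to
   (R / L Z) x T^(k+1) for any lattice defining the flat torus factor. *)
Section Metric.
Variables (R : realType) (k : nat).

Definition idx_t : 'I_k.+2 := ord0.
Definition idx_x : 'I_k.+2 := lift ord0 ord0.

Definition torus_metric (u v : R -> R) (p : 'rV[R]_k.+2) : 'M[R]_k.+2 :=
  diag_mx (\row_(i < k.+2)
    if i == idx_t then 1
    else if i == idx_x then expR (2 * u (p 0 idx_t))
    else expR (2 * v (p 0 idx_t))).

Definition dir_t : 'rV[R]_k.+2 := delta_mx 0 idx_t.
Definition dir_x (u : R -> R) (p : 'rV[R]_k.+2) : 'rV[R]_k.+2 :=
  expR (- u (p 0 idx_t)) *: delta_mx 0 idx_x.

End Metric.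

Arguments dir_t R k : clear implicits.
Arguments torus_metric [R] k u v p.

(* Main.v *)
Require Import Defs.
From HB Require Import structures.
From mathcomp Require Import all_boot all_order all_algebra.
From mathcomp Require Import all_classical all_reals all_analysis.
From mathcomp Require Import ring lra.

Set Implicit Arguments.
Unset Strict Implicit.
Unset Printing Implicit Defensive.

Import Order.TTheory GRing.Theory Num.Theory.
Import numFieldNormedType.Exports.

Local Open Scope classical_set_scope.
Local Open Scope ring_scope.

(** Write A = u', B = v'.  The condition rho_0 = C rho_1 says that
    W = (C - 1) A - k B satisfies W' = - Q(A, B) for a quadratic form Q.
    Eliminating A, Q = W (A + m B) + c B^2 with m = k (C + 1) / (C - 1) and
    c > 0, so that E = exp (u + m v) is an integrating factor:
    (E W)' = - c E B^2 <= 0.  As E W is periodic it is constant, whence B = 0;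
    Rolle's theorem for u gives a zero of W = (C - 1) A, so A = 0. *)

(** * Periodic functions and the differential equation for the exponents *)

Lemma periodic_nonincreasing_constant (R : realType) (f f' : R -> R) (L : R) :
  0 < L -> periodic f L -> (forall t : R, is_derive t 1 f (f' t)) ->
  (forall t, f' t <= 0) -> forall s t, f s = f t.
Proof.
move=> L0 fL df f'0.
have fnincr s t : s <= t -> f t <= f s.
  move=> st; apply: (@ler0_derive1_nincr _ f s t) => //.
  - by move=> x _; rewrite derive1E; have := df x; rewrite derive_val.
  - by apply: derivable_within_continuous => x _; have := df x.
(* Adding enough periods to [s] moves it beyond [t] without changing the value of [f]. *)
have fle s t : f s <= f t.
  rewrite -(periodicn fL (Num.truncn ((t - s) / L)).+1 s); apply: fnincr.
  rewrite -lerBlDl -mulr_natl -ler_pdivrMr// ltW//.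
  exact: truncnS_gt.
by move=> s t; apply/le_anti; rewrite !fle.
Qed.

Lemma is_derive_constant (R : realType) (f : R -> R) (t d : R) :
  (forall s s', f s = f s') -> is_derive t 1 f d -> d = 0.
Proof.
move=> fC df; rewrite -(derive_val (is_derive := df)).
rewrite (_ : f = cst (f t)) ?derive_cst//.
by apply/funext => s; exact: fC.
Qed.

(** Since [f] equals its shift by [L], both [f' t] and [f' (t + L)] are its derivative at [t]. *)
Lemma periodic_derive (R : realType) (f f' : R -> R) (L : R) :
  periodic f L -> (forall t : R, is_derive t 1 f (f' t)) -> periodic f' L.
Proof.
move=> fL df t.
have df' : is_derive t 1 f (f' (t + L)).
  rewrite (_ : f = f \o shift L); last by apply/funext => s /=; rewrite fL.
  rewrite -[f' _]mulr1; apply: (@is_derive1_comp _ f (shift L)) => //.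
  by apply: is_derive_eq; rewrite addr0.
by rewrite -[LHS](derive_val (is_derive := df'))
  -[RHS](derive_val (is_derive := df t)).
Qed.

(** The analytic core: the equation is rho_0 = C rho_1 with both signs reversed, for a real
    parameter [k]. *)
Lemma warping_ode_rigidity (R : realType) (k C L : R)
    (u v u1 v1 u2 v2 : R -> R) :
  1 <= k -> 1 < C -> 0 < L -> periodic u L -> periodic v L ->
  (forall t : R, is_derive t 1 u (u1 t)) ->
  (forall t : R, is_derive t 1 v (v1 t)) ->
  (forall t : R, is_derive t 1 u1 (u2 t)) ->
  (forall t : R, is_derive t 1 v1 (v2 t)) ->
  (forall t, u2 t + u1 t ^+ 2 + k * (v2 t + v1 t ^+ 2) =
     C * (u2 t + u1 t ^+ 2 + k * (u1 t * v1 t))) ->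
  (forall s t, u s = u t) /\ (forall s t, v s = v t).
Proof.
move=> k1 C1 L0 uL vL du dv du1 dv1 ode.
have CN0 : C - 1 != 0 by rewrite subr_eq0 gt_eqF.
(* Here Q = (C - 1) A^2 + C k A B - k B^2, and [m] solves (C - 1) m - k = C k, matching the A B
   terms. *)
pose m := k * (C + 1) / (C - 1).
pose E t := expR (u t + m * v t).
pose W t := (C - 1) * u1 t - k * v1 t.
(* Matching the B^2 terms leaves c = k (m - 1), positive because k (C + 1) >= C + 1 > C - 1. *)
pose c := k * (k * (C + 1) - (C - 1)) / (C - 1).
have c0 : 0 < c.
  rewrite divr_gt0 ?subr_gt0// mulr_gt0//; first by lra.
  by nra.
have u1L := periodic_derive uL du.
have v1L := periodic_derive vL dv.
have dE (t : R) : is_derive t 1 E (E t * (u1 t + m * v1 t)).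
  exact: (is_derive1_comp (is_derive_expR _)
            (is_deriveD (du t) (is_deriveZ m (dv t)))).
have dW (t : R) : is_derive t 1 W ((C - 1) * u2 t - k * v2 t).
  exact: (is_deriveB (is_deriveZ (C - 1) (du1 t)) (is_deriveZ k (dv1 t))).
have dEW (t : R) : is_derive t 1 (E * W) (- c * E t * v1 t ^+ 2).
  apply: is_derive_eq.
  rewrite /W /=.
  (* The equation solved for W'; the right-hand side is -Q(A, B). *)
  have -> : (C - 1) * u2 t - k * v2 t =
      - (C - 1) * u1 t ^+ 2 + k * v1 t ^+ 2 - C * k * (u1 t * v1 t).
    by have := ode t; lra.
  by rewrite /c /m /GRing.scale /=; field.
have EWL : periodic (E * W) L.
  by move=> t; rewrite !fctE /E /W uL vL u1L v1L.
have EW0 t : - c * E t * v1 t ^+ 2 <= 0.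
  rewrite !mulNr oppr_le0; apply: mulr_ge0 (sqr_ge0 _).
  exact: mulr_ge0 (ltW c0) (expR_ge0 _).
have EWC := periodic_nonincreasing_constant L0 EWL dEW EW0.
have v10 t : v1 t = 0.
  have /eqP := is_derive_constant EWC (dEW t).
  rewrite !mulf_eq0 oppr_eq0 (gt_eqF c0) gt_eqF ?expR_gt0//= orbb.
  by move/eqP.
have [x _ dux] : exists2 x, x \in `]0, L[%R & is_derive x 1 u 0.
  apply: Rolle => //.
  - by apply: derivable_within_continuous => x _; have := du x.
  - by rewrite -(uL 0) add0r.
have u1x : u1 x = 0.
  by rewrite -(derive_val (is_derive := du x)) derive_val.
(* The constant E W vanishes at [x], hence everywhere; with B = 0 it equals (C - 1) E A. *)
have u10 t : u1 t = 0.
  have := EWC t x; rewrite /GRing.mul /= /W u1x !v10 !mulr0 !subr0 mulr0.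
  by move=> /eqP; rewrite !mulf_eq0 gt_eqF ?expR_gt0//= (negbTE CN0) => /eqP.
split=> s t; apply: is_derive_0_is_cst => y.
- by have := du y; rewrite u10.
- by have := dv y; rewrite v10.
Qed.

(** * Curvature of the metrics dt^2 + sum_i exp(2 w_i(t)) dx_i^2 *)

Lemma invmx_diag (F : fieldType) n (d : 'rV[F]_n) :
  (forall i, d 0 i != 0) -> invmx (diag_mx d) = diag_mx (\row_i (d 0 i)^-1).
Proof.
move=> d0; set D := diag_mx (\row__ _).
have DV : diag_mx d *m D = 1%:M.
  rewrite mulmx_diag -diag_const_mx; congr diag_mx.
  by apply/rowP => i; rewrite !mxE mulfV.
by rewrite -[RHS](mulKmx (mulmx1_unit DV).1) DV mulmx1.
Qed.

Section WarpedMetric.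
Variables (R : realType) (n : nat) (o : 'I_n).
Variables (g : 'rV[R]_n -> 'M[R]_n) (w w1 w2 : 'I_n -> R -> R).
(** One exponent per coordinate treats x and all the y_alpha uniformly; [wo] below makes the
    coordinate [o] the arclength t. *)
Hypothesis gE :
  forall p, g p = diag_mx (\row_i expR (2 * w i (p 0 o))).
Hypothesis dw : forall i (t : R), is_derive t 1 (w i) (w1 i t).
Hypothesis dw1 : forall i (t : R), is_derive t 1 (w1 i) (w2 i t).
Hypothesis wo : forall t, w o t = 0.

(** Along the i-th axis the coordinate [o] moves with speed 1 or 0, so the difference quotient is
    literally one of [h]. *)
Lemma partial_time (i : 'I_n) (h : R -> R) (p : 'rV[R]_n) (h' : R) :
  is_derive (p 0 o) 1 h h' ->
  partial i (fun q : 'rV[R]_n => h (q 0 o)) p = (i == o)%:R * h'.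
Proof.
move=> dh; rewrite /partial.
rewrite (_ : 'D_(delta_mx 0 i) _ p = 'D_((i == o)%:R : R) h (p 0 o)).
  by case: eqP => _; rewrite ?derive0 ?mul0r// derive_val mul1r.
rewrite /derive; set F := (X in lim (X @ _) = _).
suff -> : F = fun s =>
  s^-1 *: ((h \o shift (p 0 o)) (s *: (i == o)%:R) - h (p 0 o)) by [].
by apply/funext => s /=; rewrite /F/= !mxE eqxx eq_sym.
Qed.

Lemma warp1_time t : w1 o t = 0.
Proof.
by apply: is_derive_constant (dw o t) => s s'; rewrite !wo.
Qed.

Lemma warp2_time t : w2 o t = 0.
Proof.
by apply: is_derive_constant (dw1 o t) => s s'; rewrite !warp1_time.
Qed.

Lemma is_derive_warp i (t : R) :
  is_derive t 1 (fun s => expR (2 * w i s)) (expR (2 * w i t) * (2 * w1 i t)).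
Proof.
exact: (is_derive1_comp (is_derive_expR _) (is_deriveZ 2 (dw i t))).
Qed.

Lemma partial_warp a b c p :
  partial a (fun q => g q b c) p =
  ((a == o) && (b == c))%:R * (2 * w1 b (p 0 o) * expR (2 * w b (p 0 o))).
Proof.
rewrite (_ : (fun q => g q b c) =
    fun q => (fun s => expR (2 * w b s) *+ (b == c)) (q 0 o)); last first.
  by apply/funext => q; rewrite gE !mxE.
case: (b == c).
  rewrite (partial_time _ (is_derive_warp b (p 0 o))) andbT.
  by rewrite mulrCA mulrC mulrA.
by rewrite (partial_time _ (is_derive_cst _ _ _)) andbF !mul0r mulr0.
Qed.

(** The nonzero symbols are Gamma^i_oi = Gamma^i_io = w_i' and Gamma^o_ii = - w_i' exp(2 w_i), for i
    other than [o]. Kronecker deltas join them into one formula that can be differentiated and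
    summed. *)
Lemma christoffel_warp a b c p : christoffel g a b c p =
  (b == o)%:R * (a == c)%:R * w1 a (p 0 o)
  + (c == o)%:R * (a == b)%:R * w1 a (p 0 o)
  - (a == o)%:R * (b == c)%:R * (w1 b (p 0 o) * expR (2 * w b (p 0 o))).
Proof.
rewrite /christoffel gE invmx_diag; last first.
  by move=> i; rewrite mxE gt_eqF// expR_gt0.
rewrite (bigD1 a)//= big1 ?addr0; last first.
  by move=> d da; rewrite !mxE eq_sym (negbTE da) mul0r.
rewrite !mxE eqxx mulr1n !partial_warp.
set t := p 0 o; set ea := expR (2 * w a t); set eb := expR (2 * w b t).
have ea0 : ea != 0 by rewrite gt_eqF// expR_gt0.
(* For a = o the first two terms vanish with w_o'; otherwise the third vanishes and g_aa cancels
   against its inverse. *)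
have [ao|ao] /= := eqVneq a o.
  have -> : ea = 1 by rewrite /ea ao wo mulr0 expR0.
  rewrite ao warp1_time.
  by rewrite !mulr0 !(mul0r, mul1r, invr1); case: (b == c) => /=; field.
rewrite !mul0r !subr0.
by case: (b == o); case: (c == o); case: (a == b); case: (a == c) => /=; field.
Qed.

Lemma partial_christoffel_warp i a b c p :
  partial i (christoffel g a b c) p = (i == o)%:R *
  ((b == o)%:R * (a == c)%:R * w2 a (p 0 o)
   + (c == o)%:R * (a == b)%:R * w2 a (p 0 o)
   - (a == o)%:R * (b == c)%:R *
     ((w2 b (p 0 o) + 2 * w1 b (p 0 o) ^+ 2) * expR (2 * w b (p 0 o)))).
Proof.
pose f t := (b == o)%:R * (a == c)%:R * w1 a t
  + (c == o)%:R * (a == b)%:R * w1 a t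
  - (a == o)%:R * (b == c)%:R * (w1 b t * expR (2 * w b t)).
rewrite (_ : christoffel g a b c = fun q => f (q 0 o)); last first.
  by apply/funext => q; rewrite christoffel_warp.
apply: partial_time; set t := p 0 o.
have := is_deriveB (is_deriveD
  (is_deriveZ ((b == o)%:R * (a == c)%:R) (dw1 a t))
  (is_deriveZ ((c == o)%:R * (a == b)%:R) (dw1 a t)))
  (is_deriveZ ((a == o)%:R * (b == c)%:R)
    (is_deriveM (dw1 b t) (is_derive_warp b t))).
move=> df; apply: is_derive_eq df _.
by rewrite /GRing.scale /=; ring.
Qed.

(** As Gamma^e_oo = 0, only - d_o Gamma^a_ao - (Gamma^a_oa)^2 remains. *)
Lemma riemann_warp_time a p :
  riemann g a o a o p = - (w2 a (p 0 o) + w1 a (p 0 o) ^+ 2).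
Proof.
rewrite /riemann !partial_christoffel_warp (bigD1 a)//= big1; last first.
  move=> e ea; rewrite !christoffel_warp !warp1_time !eqxx.
  rewrite (eq_sym o e) (eq_sym a e) (negbTE ea); have [eo|eo] := eqVneq e o.
    by move: ea; rewrite eo eq_sym => /negbTE ->; rewrite !warp1_time /=; ring.
  by rewrite /=; ring.
rewrite !christoffel_warp !warp1_time !warp2_time !eqxx !(eq_sym o a).
have [->|ao] := eqVneq a o.
  by rewrite !warp1_time !warp2_time /=; ring.
by rewrite /=; ring.
Qed.

(** The bracket is 0 for a = b, - (w_b'' + w_b'^2) for a = o, where w_a' = 0, and - w_a' w_b'
    otherwise. *)
Lemma riemann_warp_space a b p : b != o ->
  riemann g a b a b p = expR (2 * w b (p 0 o)) *
    ((a == b)%:R * w1 b (p 0 o) ^+ 2 - w1 a (p 0 o) * w1 b (p 0 o)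
     - (a == o)%:R * (w2 b (p 0 o) + w1 b (p 0 o) ^+ 2)).
Proof.
move=> bo; rewrite /riemann !partial_christoffel_warp.
(* Only e = b and e = o contribute to the quadratic terms. *)
rewrite (bigD1 b)//= (bigD1 o) 1?eq_sym//= big1; last first.
  move=> e /andP[eb eo]; rewrite !christoffel_warp (negbTE bo) (negbTE eo).
  rewrite !(eq_sym b e) (negbTE eb).
  by rewrite /=; ring.
rewrite !christoffel_warp !warp1_time !eqxx.
rewrite !(eq_sym o b) (negbTE bo) !(eq_sym b a).
have [->|ao] := eqVneq a o.
  rewrite !warp1_time (eq_sym o b) (negbTE bo).
  by rewrite !(wo, mulr0, expR0) /=; ring.
have [->|ab] := eqVneq a b.
  by rewrite /=; ring.
by rewrite /=; ring.
Qed.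

Lemma ricci_warp_time p :
  ricci g p o o = - \sum_a (w2 a (p 0 o) + w1 a (p 0 o) ^+ 2).
Proof.
by rewrite mxE -sumrN; apply: eq_bigr => a _; exact: riemann_warp_time.
Qed.

(** In the sum over [a], the two delta terms contribute w_b'^2 with opposite signs. *)
Lemma ricci_warp_space b p : b != o ->
  ricci g p b b = - expR (2 * w b (p 0 o)) *
    (w2 b (p 0 o) + w1 b (p 0 o) * \sum_a w1 a (p 0 o)).
Proof.
move=> bo; rewrite mxE; under eq_bigr do rewrite riemann_warp_space//.
rewrite -mulr_sumr !sumrB -!mulr_suml.
have delta (x : 'I_n) : \sum_a (a == x)%:R = 1 :> R.
  by rewrite (bigD1 x)//= eqxx big1 ?addr0// => a /negbTE ->.
by rewrite !delta; ring.
Qed.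

(** The i-th component of the eigenvector equation reads Ric_ii g^ii = l once [x] is cancelled; this
    serves both [dir_t] and [dir_x]. *)
Lemma ricci_eigenvalue_warp (i : 'I_n) (x l : R) p : x != 0 ->
  ricci_eigenvalue_along g p (x *: delta_mx 0 i) l ->
  ricci g p i i = l * expR (2 * w i (p 0 o)).
Proof.
move=> x0 [_ /eigenspaceP].
rewrite -scalemxAl -rowE scalerA (mulrC l) -scalerA => /(scalerI x0).
move=> /rowP/(_ i).
rewrite !mxE !eqxx mulr1 gE invmx_diag; last first.
  by move=> j; rewrite mxE gt_eqF// expR_gt0.
rewrite (bigD1 i)//= big1 ?addr0; last first.
  by move=> j /negbTE ji; rewrite !mxE ji mulr0n mulr0.
rewrite !mxE eqxx mulr1n => <-.
by rewrite mulfVK// gt_eqF// expR_gt0.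
Qed.

End WarpedMetric.

(** * Flatness of constant metrics, and the rigidity theorem *)

Lemma flat_constant_metric (R : realType) n (g : 'rV[R]_n -> 'M[R]_n) :
  (forall p q, g p = g q) -> flat g.
Proof.
move=> gC.
have partial_constant i (f : 'rV[R]_n -> R) p :
    (forall q q', f q = f q') -> partial i f p = 0.
  move=> fC; rewrite /partial (_ : f = cst (f p)) ?derive_cst//.
  by apply/funext => q; exact: fC.
have gamma0 a b c p : christoffel g a b c p = 0.
  rewrite /christoffel big1 ?mulr0// => d _.
  by rewrite !partial_constant ?addr0 ?subrr ?mulr0// => q q';
    rewrite (gC q q').
move=> a b c d p; rewrite /riemann !partial_constant; first last.
- by move=> q q'; rewrite !gamma0.
- by move=> q q'; rewrite !gamma0.
by rewrite subrr add0r big1// => e _; rewrite !gamma0 mulr0 subrr.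
Qed.

Theorem proposition7p3 (R : realType) (k : nat) (C L : R) (u v : R -> R)
    (rho0 rho1 : 'rV[R]_k.+2 -> R)
    (hk : (1 <= k)%N) (hC : 1 < C) (hL : 0 < L)
    (u_smooth : smooth u) (v_smooth : smooth v)
    (u_periodic : periodic u L) (v_periodic : periodic v L)
    (hrho0 : forall p, ricci_eigenvalue_along (torus_metric k u v) p
                         (dir_t R k) (rho0 p))
    (hrho1 : forall p, ricci_eigenvalue_along (torus_metric k u v) p
                         (dir_x u p) (rho1 p))
    (hrho : forall p, rho0 p = C * rho1 p) :
  [/\ (exists a : R, forall t, u t = a),
      (exists b : R, forall t, v t = b)
    & flat (torus_metric k u v)].
Proof.
have du m (t : R) : is_derive t 1 (derive1n m u) (derive1n m.+1 u t).
  by rewrite derive1nS derive1E; apply: DeriveDef => //; exact: u_smooth.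
have dv m (t : R) : is_derive t 1 (derive1n m v) (derive1n m.+1 v t).
  by rewrite derive1nS derive1E; apply: DeriveDef => //; exact: v_smooth.
(* [w m i] is the m-th derivative of the exponent of coordinate [i]; orders 0, 1 and 2 are the data
   of the curvature formulas. *)
pose w m (i : 'I_k.+2) : R -> R := if i == idx_t k then cst 0
  else if i == idx_x k then derive1n m u else derive1n m v.
have dw m i (t : R) : is_derive t 1 (w m i) (w m.+1 i t).
  rewrite /w; case: (i == _); first exact: is_derive_cst.
  by case: (i == _).
have gE p : torus_metric k u v p =
    diag_mx (\row_i expR (2 * w 0 i (p 0 (idx_t k)))).
  rewrite /torus_metric; congr diag_mx; apply/rowP => i; rewrite !mxE /w.
  by case: ifP => _; [rewrite mulr0 expR0|case: ifP].
have w0 t : w 0 (idx_t k) t = 0 by rewrite /w eqxx.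
have wx m : w m (idx_x k) = derive1n m u by [].
(* The terms for t and x are split off; the [k] terms for the y_alpha are equal. *)
have sumw (F : R -> R -> R) m m' t :
    \sum_i F (w m i t) (w m' i t) =
    F 0 0 + F (derive1n m u t) (derive1n m' u t)
    + k%:R * F (derive1n m v t) (derive1n m' v t).
  rewrite 2!big_ord_recl /w /= addrA; congr (_ + _).
  by rewrite sumr_const card_ord mulr_natl.
have ode t : derive1n 2 u t + derive1n 1 u t ^+ 2
      + k%:R * (derive1n 2 v t + derive1n 1 v t ^+ 2) =
    C * (derive1n 2 u t + derive1n 1 u t ^+ 2
      + k%:R * (derive1n 1 u t * derive1n 1 v t)).
  pose p : 'rV[R]_k.+2 := const_mx t.
  have pt : p 0 (idx_t k) = t by rewrite mxE.
  have := hrho0 p; rewrite /dir_t -[delta_mx _ _]scale1r.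
  move=> /(ricci_eigenvalue_warp gE (oner_neq0 _)).
  rewrite (ricci_warp_time gE (dw 0) (dw 1) w0) w0 mulr0 expR0 mulr1 pt.
  rewrite (sumw (fun x y => x + y ^+ 2)) => r0.
  have /(ricci_eigenvalue_warp gE) := hrho1 p.
  move=> /(_ (lt0r_neq0 (expR_gt0 _))).
  rewrite (ricci_warp_space gE (dw 0) (dw 1) w0)// pt.
  rewrite (sumw (fun x _ => x) 1 1) !wx mulrC mulrN -mulNr => r1.
  (* Cancelling g_xx = exp(2 u) in [r1] gives rho_1 = - (A' + A (A + k B)). *)
  have E0 : expR (2 * u t) != 0 by rewrite gt_eqF// expR_gt0.
  have := hrho p; rewrite -r0 -(mulIf E0 r1).
  lra.
have k1 : 1 <= k%:R :> R by rewrite ler1n.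
have [uC vC] := warping_ode_rigidity k1 hC hL u_periodic v_periodic
  (du 0) (dv 0) (du 1) (dv 1) ode.
split; [by exists (u 0) => t|by exists (v 0) => t|].
apply: flat_constant_metric => p q; rewrite /torus_metric.
by rewrite (uC (p 0 _) (q 0 (idx_t k))) (vC (p 0 _) (q 0 (idx_t k))).
Qed.
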